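(* Let $n, m$ be integers with $n\geq 3$ and $m\geq 2$. Then the metric dimension of the jellyfish graph $JFG(n,m)$ is $nm-n$.
   Context: For integers $n\ge 3$, $m\ge 1$, the jellyfish graph $JFG(n,m)$ is the simple undirected graph of order $nm+n$ with vertex set $\{1,\dots,n\}\cup\{v_{ij} : 1\le i\le n,\ 1\le j\le m\}$ in which: the vertices $1,\dots,n$ induce the cycle $C_n$ (with edges $\{i,i+1\}$ for $1\le i\le n-1$ and $\{n,1\}$); each vertex $v_{ij}$ has degree $1$ and is adjacent exactly to $i$; there are no other edges. For a finite connected graph $\Gamma$ with graph distance $d$, a set $W=\{w_1,\dots,w_k\}$ of vertices is a resolving set if the vectors $r(v|W)=(d(v,w_1),\dots,d(v,w_k))$, $v\in V(\Gamma)$, are pairwise distinct. The metric dimension $\beta(\Gamma)$ is the minimum cardinality of a resolving set of $\Gamma$. *)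

(* Defs.v *)
From mathcomp Require Import all_boot.

Set Implicit Arguments.
Unset Strict Implicit.
Unset Printing Implicit Defensive.

Lemma bigminn_le (I : finType) (P : pred I) (F : I -> nat) (d : nat) (i : I) :
  P i -> \big[minn/d]_(j | P j) F j <= F i.
Proof.
move=> Pi; have := mem_index_enum i; elim: (index_enum I) => //= j s IHs.
rewrite inE big_cons => /predU1P[<-|/IHs le]; first by rewrite Pi geq_minl.
by case: ifP => // _; apply: leq_trans (geq_minr _ _) le.
Qed.

Section MetricDimension.
Variables (T : finType) (e : rel T).

Definition walk (k : nat) (x y : T) : bool :=
  [exists p : k.-tuple T, path e x p && (last x p == y)].

(* A shortest walk has fewer than #|T| edges, so in a connected graph the
   minimum is over a nonempty range and the default #|T| is never reached
   (#|T| is the value given to disconnected pairs; see gdistP). *)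
Definition gdist (x y : T) : nat :=
  \big[minn/#|T|]_(k < #|T| | walk k x y) k.

(* r(v|W), with W listed in the order of enum W. *)
Definition metric_repr (W : {set T}) (v : T) : seq nat :=
  [seq gdist v w | w <- enum W].

Definition resolving (W : {set T}) : bool := injectiveb (metric_repr W).

(* The full vertex set is always resolving (see resolving_setT), so the
   default #|T| does not change the minimum. *)
Definition metric_dim : nat :=
  \big[minn/#|T|]_(W : {set T} | resolving W) #|W|.

Lemma gdistP (x y : T) : connect e x y ->
  walk (gdist x y) x y /\ (forall k, walk k x y -> gdist x y <= k).
Proof.
move=> /connectP[p0 ep0 y_last].
have short k : walk k x y -> exists2 j, j < #|T| & (j <= k) && walk j x y.
  move=> /existsP[p /andP[ep /eqP <-]].
  case: (shortenP ep) => p' ep' up' sub.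
  exists (size p').
    by have := card_uniqP up'; rewrite /= => <-; apply: max_card.
  apply/andP; split.
    rewrite -(size_tuple p); apply: uniq_leq_size => //.
    by case/andP: up'.
  by apply/existsP; exists (in_tuple p'); rewrite ep' /=.
have minP (j : nat) : j < #|T| -> walk j x y -> gdist x y <= j.
  by move=> ltj wj; apply: (bigminn_le _ _ (i := Ordinal ltj)).
have w0 : walk (size p0) x y.
  by apply/existsP; exists (in_tuple p0); rewrite ep0 /= -y_last.
have [j0 ltj0 /andP[_ wj0]] := short _ w0.
split.
  have : (gdist x y < #|T|) ==> walk (gdist x y) x y.
    rewrite {1 2}/gdist; elim/big_ind: _ => [|a b Ha Hb|k wk].
    - by rewrite ltnn.
    - by rewrite /minn; case: ifP.
    - by apply/implyP.
  by move/implyP; apply; apply: leq_ltn_trans (minP _ ltj0 wj0) ltj0.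
by move=> k /short[j ltj /andP[lejk wj]]; apply: leq_trans (minP _ ltj wj) lejk.
Qed.

Lemma gdist_eq0 (x y : T) : (gdist x y == 0) = (x == y).
Proof.
have T0 : 0 < #|T| by apply/card_gt0P; exists x.
apply/idP/eqP => [|<-].
  move=> /eqP g0; have : (gdist x y == 0) ==> (x == y).
    rewrite {1}/gdist; elim/big_ind: _ => [|a b Ha Hb|k wk].
    - by rewrite -leqn0 leqNgt T0.
    - by rewrite /minn; case: ifP.
    - apply/implyP=> /eqP k0; move: wk; rewrite k0 => /existsP[p].
      by rewrite tuple0 /=.
  by rewrite g0 eqxx => /eqP.
rewrite -leqn0; apply: (gdistP (connect0 e x)).2.
by apply/existsP; exists [tuple]; rewrite /= eqxx.
Qed.

Lemma resolving_setT : resolving [set: T].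
Proof.
apply/injectiveP => x y /eq_in_map rxy.
have : gdist x x = gdist y x by apply: rxy; rewrite mem_enum inE.
have /eqP-> : gdist x x == 0 by rewrite gdist_eq0.
by move=> /esym/eqP; rewrite gdist_eq0 => /eqP.
Qed.

End MetricDimension.

(* inl i is the cycle vertex i and inr (i, j) is the pendant vertex v_ij,
   with indices starting from 0; ordS i is i + 1 modulo n. *)
Definition jellyfish_vertex (n m : nat) : finType := ('I_n + 'I_n * 'I_m)%type.

Definition jellyfish (n m : nat) : rel (jellyfish_vertex n m) :=
  fun x y => match x, y with
  | inl i, inl j => (j == ordS i) || (i == ordS j)
  | inl i, inr (k, _) => i == k
  | inr (k, _), inl i => i == k
  | inr _, inr _ => false
  end.
Arguments jellyfish : clear implicits.

Lemma card_jellyfish_vertex n m : #|jellyfish_vertex n m| = n * m + n.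
Proof. by rewrite card_sum card_prod !card_ord addnC. Qed.

Lemma jellyfish_sym n m : symmetric (jellyfish n m).
Proof. by move=> [i|[i a]] [j|[j b]] //=; rewrite orbC. Qed.

Lemma jellyfish_irr n m : 1 < n -> irreflexive (jellyfish n m).
Proof.
move=> n1 [i|[i a]] //=; rewrite orbb; apply/negbTE/eqP => /(congr1 val) /=.
have := ltn_ord i; rewrite leq_eqVlt => /orP[/eqP e|lt] /=.
  by rewrite e modnn => i0; rewrite i0 in e; rewrite -e in n1.
by rewrite modn_small // => /eqP; rewrite -[X in X == _]addn0 -addn1 eqn_add2l.
Qed.

Lemma jellyfish_connected n m x y : connect (jellyfish n m) x y.
Proof.
have csym := sym_connect_sym (@jellyfish_sym n m).
wlog [i ->] : x / exists i, x = inl i.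
  move=> IH; case: x => [i|[i a]]; first by apply: IH; exists i.
  apply: connect_trans (IH (inl i) _); last by exists i.
  by apply: connect1; rewrite /= eqxx.
wlog [j ->] : y / exists j, y = inl j.
  move=> IH; case: y => [j|[j b]]; first by apply: IH; exists j.
  apply: connect_trans (IH (inl j) _) _; first by exists j.
  by apply: connect1; rewrite /= eqxx.
wlog lij : i j / i <= j.
  move=> IH; have [/IH //|/ltnW/IH] := leqP i j; by rewrite csym.
have [d dE] : exists d, j = i + d :> nat by exists (j - i); rewrite subnKC.
elim: d j dE {lij} => [|d IHd] j dE.
  by have -> : i = j by apply: val_inj; rewrite /= dE addn0.
have ltd : i + d < n by have := ltn_ord j; rewrite dE addnS; apply: ltnW.
apply: connect_trans (IHd (Ordinal ltd) (erefl _)) _; apply: connect1 => /=.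
apply/orP; left; apply/eqP/val_inj => /=.
by rewrite dE addnS modn_small // -addnS -dE.
Qed.

(* Main.v *)
Require Import Defs.
From mathcomp Require Import all_boot.

Set Implicit Arguments.
Unset Strict Implicit.
Unset Printing Implicit Defensive.

(** Two pendant vertices at the same cycle vertex have equal distances to every
    third vertex, so a resolving set misses at most one pendant vertex per cycle
    vertex, which gives at least [n * m - n] elements. Conversely, take all
    pendant vertices but one at each cycle vertex: since [m >= 2], every cycle
    vertex [i] keeps a chosen pendant vertex, and [i] is the only vertex at
    distance 1 from it; an omitted pendant vertex is one step further than its
    support from every chosen vertex. *)

Section Distance.
Variables (T : finType) (e : rel T).

Lemma walkS k x y : walk e k.+1 x y = [exists z, e x z && walk e k z y].
Proof.
apply/existsP/existsP => [[p]|[z /andP[exz /existsP[p /andP[ep lp]]]]].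
  case/tupleP: p => z p /= /andP[/andP[exz ep] lp].
  by exists z; rewrite exz; apply/existsP; exists p; rewrite ep.
by exists (cons_tuple z p); rewrite /= exz ep.
Qed.

Lemma walk0 x y : walk e 0 x y = (x == y).
Proof.
apply/existsP/idP => [[p]|xy]; first by rewrite tuple0.
by exists [tuple].
Qed.

Lemma connect_walk k x y : walk e k x y -> connect e x y.
Proof. by case/existsP=> p /andP[ep /eqP <-]; apply/connectP; exists p. Qed.

Lemma gdist_le_walk k x y : walk e k x y -> gdist e x y <= k.
Proof. by move=> wk; apply: (gdistP (connect_walk wk)).2. Qed.

Lemma gdist_eq1 x y : connect e x y -> x != y -> (gdist e x y == 1) = e x y.
Proof.
move=> cxy nxy; apply/eqP/idP => [d1|exy].
  have := (gdistP cxy).1; rewrite d1 walkS => /existsP[z].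
  by rewrite walk0 => /andP[exz /eqP <-].
apply/eqP; rewrite eqn_leq lt0n gdist_eq0 nxy andbT; apply: gdist_le_walk.
by rewrite walkS; apply/existsP; exists y; rewrite exy walk0 eqxx.
Qed.

(** As [x != y], a shortest walk from [x] takes at least one step, which can only lead to [u];
    conversely, any walk from [u] extends by the edge from [x]. *)
Lemma gdist_leaf x u y : (forall z, e x z = (z == u)) ->
  connect e x y -> x != y -> gdist e x y = (gdist e u y).+1.
Proof.
move=> xu cxy nxy; have := (gdistP cxy).1.
have : gdist e x y != 0 by rewrite gdist_eq0.
case dE: (gdist e x y) => [//|d] _; rewrite walkS => /existsP[z].
rewrite xu => /andP[/eqP-> wd]; congr _.+1; apply/eqP.
rewrite eqn_leq gdist_le_walk // andbT -ltnS -dE; apply: gdist_le_walk.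
rewrite walkS; apply/existsP; exists u; rewrite xu eqxx /=.
exact: (gdistP (connect_walk wd)).1.
Qed.

Lemma resolvingP (W : {set T}) :
  reflect (forall x y, {in W, forall w, gdist e x w = gdist e y w} -> x = y)
          (resolving e W).
Proof.
apply: (iffP (injectiveP _)) => [inj x y eqxy|H x y /eq_in_map eqxy].
  by apply/inj/eq_in_map => w; rewrite mem_enum; apply: eqxy.
by apply: H => w wW; apply: eqxy; rewrite mem_enum.
Qed.

Lemma leq_metric_dim d : (forall W : {set T}, resolving e W -> d <= #|W|) ->
  d <= metric_dim e.
Proof.
move=> H; rewrite /metric_dim; elim/big_ind: _ => //.
(* The default [#|T|] of the minimum is the size of the full vertex set, which is resolving. *)
- by rewrite -cardsT; apply/H/resolving_setT.
- by move=> a b da db; rewrite leq_min da.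
Qed.

Lemma metric_dim_leq (W : {set T}) : resolving e W -> metric_dim e <= #|W|.
Proof. exact: bigminn_le. Qed.

End Distance.

Section Jellyfish.
Variables n m : nat.
Local Notation J := (jellyfish n m).

Lemma gdist_pendant i a y : y != inr (i, a) ->
  gdist J (inr (i, a)) y = (gdist J (inl i) y).+1.
Proof.
move=> yx; apply: gdist_leaf; last by rewrite eq_sym.
  by case=> [j|[j b]].
exact: jellyfish_connected.
Qed.

Lemma gdist_pendant_eq1 y i a : (gdist J y (inr (i, a)) == 1) = (y == inl i).
Proof.
have [->|ny] := eqVneq y (inr (i, a)).
  by have /eqP-> : gdist J (inr (i, a)) (inr (i, a)) == 0 by rewrite gdist_eq0.
rewrite gdist_eq1 //; last exact: jellyfish_connected.
by case: y {ny} => [j|[j b]].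
Qed.

Lemma resolving_jellyfish_card (W : {set jellyfish_vertex n m}) :
  resolving J W -> n * m - n <= #|W|.
Proof.
move=> /resolvingP res.
(* [M] indexes the omitted pendant vertices; injectivity of [fst] on it says that each cycle vertex
   has at most one. *)
pose M := [set p : 'I_n * 'I_m | inr p \notin W].
have injM : {in M &, injective fst}.
  move=> [i a] [j b]; rewrite !inE /= => aW bW ij; subst j.
  suff [->] : inr (i, a) = inr (i, b) :> jellyfish_vertex n m by [].
  apply: res => w wW; rewrite !gdist_pendant //.
    by apply: contraNneq bW => <-.
  by apply: contraNneq aW => <-.
have leM : #|M| <= n.
  by rewrite -(card_in_imset injM) -[leqRHS]card_ord; apply: max_card.
have leW : #|~: M| <= #|W|.
  rewrite -(card_imset (~: M) (@inr_inj 'I_n _)); apply/subset_leq_card.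
  by apply/subsetP => _ /imsetP[p + ->]; rewrite !inE negbK.
have := cardsC M; rewrite card_prod !card_ord => <-.
by rewrite leq_subLR leq_add.
Qed.

(** The same index [a0] is omitted at every cycle vertex, so a single [a1] other than [a0] gives a
    chosen pendant vertex everywhere. *)
Lemma resolving_pendants (a0 : 'I_m) : 1 < m ->
  resolving J [set inr p | p in setX [set: 'I_n] [set~ a0]].
Proof.
move=> m1; set W := imset _ _.
have WE i a : (inr (i, a) \in W) = (a != a0).
  by rewrite mem_imset ?inE //; apply: inr_inj.
have [a1 a1W] : exists a1, a1 \in [set~ a0].
  by apply/card_gt0P; rewrite cardsC1 card_ord -ltnS prednK // ltnW.
have {}a1W i : inr (i, a1) \in W by move: a1W; rewrite WE !inE.
(* A chosen vertex is the only one at distance 0 from itself. *)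
have chosen x y : {in W, forall w, gdist J x w = gdist J y w} ->
    x \in W -> x = y.
  move=> eqxy xW; apply/esym/eqP; rewrite -(gdist_eq0 J) -eqxy //.
  by rewrite gdist_eq0.
have cyclic i y : {in W, forall w, gdist J (inl i) w = gdist J y w} ->
    inl i = y.
  move=> eqxy; apply/esym/eqP.
  by rewrite -(gdist_pendant_eq1 y i a1) -eqxy // gdist_pendant_eq1.
apply/resolvingP => x y eqxy.
have eqyx : {in W, forall w, gdist J y w = gdist J x w}.
  by move=> w /eqxy.
have [xW|xW] := boolP (x \in W); first exact: chosen.
have [yW|yW] := boolP (y \in W); first exact/esym/chosen.
case: x => [i|[i a]] in xW eqxy eqyx *; first exact: cyclic.
case: y => [j|[j b]] in yW eqxy eqyx *; first exact/esym/cyclic.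
(* Two omitted pendant vertices remain. The first is at distance 2 from [inr (i, a1)], hence so is
   the second, whose support is then at distance 1 and equals [inl i]; both have index [a0]. *)
have /eqP := eqxy _ (a1W i).
rewrite !gdist_pendant; first last.
- by apply: contraNneq xW => <-.
- by apply: contraNneq yW => <-.
have /eqP-> : gdist J (inl i) (inr (i, a1)) == 1.
  by rewrite gdist_pendant_eq1.
rewrite eqSS eq_sym gdist_pendant_eq1 => /eqP[->].
by move: xW yW; rewrite !WE !negbK => /eqP-> /eqP->.
Qed.

End Jellyfish.

Theorem theorem3p1 (n m : nat) (hn : 3 <= n) (hm : 2 <= m) :
  metric_dim (jellyfish n m) = n * m - n.
Proof.
apply/eqP; rewrite eqn_leq; apply/andP; split; last first.
  by apply: leq_metric_dim => W; apply: resolving_jellyfish_card.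
(* The omitted index is 0, leaving [n * (m - 1)] chosen vertices. *)
apply: leq_trans (metric_dim_leq (resolving_pendants n (Ordinal (ltnW hm)) hm)) _.
rewrite card_imset; last exact: inr_inj.
by rewrite cardsX cardsT cardsC1 !card_ord -subn1 mulnBr muln1.
Qed.
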